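(* Let $H:\mathbb R^N\to[0,\infty)$ be a Finsler norm as described in the context. There exists a constant $C_H>0$ depending on $H$ such that the following holds. Let $\Omega\subset\mathbb R^N$ be an open set. Then for any function $u\in C^1(\Omega)\cap C^2(\{\nabla u\neq0\})$ and any $x\in\{\nabla u\ne0\}$, at the point $x$, $$\sum_{i=1}^N\langle D^2H(\nabla u)\nabla u_i,\nabla u_i\rangle-\langle D^2H(\nabla u)\nabla|\nabla u|,\nabla|\nabla u|\rangle\ \ge\ \frac{C_H}{H(\nabla u)}\,|\nabla u|^2\sum_{i=1}^{N-1}k_{i,u}^2,$$ where $u_i=\partial u/\partial x_i$ and $k_{i,u}(x)$, $i=1,\dots,N-1$, denote the principal curvatures at $x$ of the level set $L_{u,x}=\{y\in\Omega:u(y)=u(x)\}$ of $u$.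
   Context: $H:\mathbb R^N\to[0,\infty)$ is a Finsler norm of class $C^{3,\beta}_{loc}(\mathbb R^N\setminus\{0\})$ (for some $\beta\in(0,1)$): (i) $H(\xi)>0$ for $\xi\neq0$; (ii) $H(s\xi)=|s|H(\xi)$ for all $s\in\mathbb R$, $\xi\in\mathbb R^N$; (iii) $H$ is uniformly elliptic, i.e. $\{\xi:H(\xi)<1\}$ is uniformly convex (the principal curvatures of its boundary are all strictly positive): there is $\Lambda>0$ with $\langle D^2H(\xi)v,v\rangle\ge\Lambda|v|^2$ for all $\xi$ with $H(\xi)=1$ and all $v\in\nabla H(\xi)^\perp$. Near a point $x$ with $\nabla u(x)\ne0$ the level set $L_{u,x}$ is a $C^2$ hypersurface of $\mathbb R^N$, so its principal curvatures at $x$ are defined up to a common sign. $\nabla|\nabla u|$ denotes the gradient of the function $y\mapsto|\nabla u(y)|$ (Euclidean norm). *)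

(* Defs.v *)
From mathcomp Require Import all_boot all_order all_algebra.
From mathcomp Require Import all_classical all_reals all_analysis.
Set Implicit Arguments.
Unset Strict Implicit.
Unset Printing Implicit Defensive.
Import Order.TTheory GRing.Theory Num.Theory.
Import numFieldNormedType.Exports.
Local Open Scope classical_set_scope.
Local Open Scope ring_scope.

(* R^N is 'rV[R]_N. Its library norm `|_| is the sup norm (same topology); the
   Euclidean structure is given by dot and enorm. *)
Definition dot (R : realType) (N : nat) (v w : 'rV[R]_N) : R :=
  \sum_(i < N) v 0 i * w 0 i.

Definition enorm (R : realType) (N : nat) (v : 'rV[R]_N) : R :=
  Num.sqrt (dot v v).

Definition partial (R : realType) (N : nat) (i : 'I_N) (f : 'rV[R]_N -> R) :
    'rV[R]_N -> R :=
  fun x => 'D_(delta_mx 0 i) f x.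

Definition grad (R : realType) (N : nat) (f : 'rV[R]_N -> R) (x : 'rV[R]_N) :
    'rV[R]_N :=
  \row_(i < N) partial i f x.

Definition hess (R : realType) (N : nat) (f : 'rV[R]_N -> R) (x : 'rV[R]_N) :
    'M[R]_N :=
  \matrix_(i < N, j < N) partial i (partial j f) x.

(* f is of class C^k on the open set D: a C^(k+1) function is a (Frechet)
   differentiable one whose differential, i.e. whose partial derivatives, are
   C^k. Openness of D is left to the places of use. *)
Fixpoint class_C (R : realType) (N : nat) (k : nat) (D : set 'rV[R]_N)
    (f : 'rV[R]_N -> R) : Prop :=
  if k is k'.+1 then
    (forall x, D x -> differentiable f x) /\
    (forall i : 'I_N, class_C k' D (partial i f))
  else forall x, D x -> {for x, continuous f}.

Definition holder_loc (R : realType) (N : nat) (beta : R) (D : set 'rV[R]_N)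
    (f : 'rV[R]_N -> R) : Prop :=
  forall K : set 'rV[R]_N, compact K -> K `<=` D ->
    exists M : R, forall x y, K x -> K y ->
      `|f x - f y| <= M * enorm (x - y) `^ beta.

Definition class_C_holder_loc (R : realType) (N : nat) (k : nat) (beta : R)
    (D : set 'rV[R]_N) (f : 'rV[R]_N -> R) : Prop :=
  class_C k D f /\
  forall s : k.-tuple 'I_N, holder_loc beta D (foldr (@partial R N) f s).

Record finsler_norm (R : realType) (N : nat) (H : 'rV[R]_N -> R) : Prop := {
  finsler_ge0 : forall xi, 0 <= H xi;
  finsler_regular : exists beta : R, [/\ 0 < beta, beta < 1 &
    class_C_holder_loc 3 beta [set xi | xi != 0] H];
  finsler_gt0 : forall xi, xi != 0 -> 0 < H xi;
  finsler_homogeneous : forall (s : R) xi, H (s *: xi) = `|s| * H xi;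
  finsler_elliptic : exists Lambda : R, 0 < Lambda /\
    forall xi v, H xi = 1 -> dot (grad H xi) v = 0 ->
      Lambda * enorm v ^+ 2 <= dot (v *m hess H xi) v }.

(* In a box around x, and in the orthonormal frame made of nu and of the rows
   of T, the set S is the graph {x + w T + g(w) nu} of a C^2 function g of N-1
   variables whose graph is tangent at x to the span of the rows of T. *)
Definition local_graph (R : realType) (N : nat) (S : set 'rV[R]_N)
    (x nu : 'rV[R]_N) (T : 'M[R]_(N.-1, N)) (g : 'rV[R]_(N.-1) -> R) : Prop :=
  [/\ nu *m nu^T = 1%:M, T *m T^T = 1%:M & T *m nu^T = 0] /\
  [/\ g 0 = 0, grad g 0 = 0 &
      exists2 r : R, 0 < r & class_C 2 (ball 0 r) g /\
        forall (w : 'rV[R]_(N.-1)) (t : R), `|w| < r -> `|t| < r ->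
          (S (x + w *m T + t *: nu) <-> t = g w)].

(* The principal curvatures of the hypersurface S at x are the eigenvalues,
   with multiplicity, of D^2 g(0), where S is near x the graph of g over its
   tangent hyperplane at x. Replacing nu by - nu changes k into - k, and k is
   determined up to this sign and up to a permutation. *)
Definition principal_curvatures (R : realType) (N : nat) (S : set 'rV[R]_N)
    (x : 'rV[R]_N) (k : 'I_(N.-1) -> R) : Prop :=
  exists (nu : 'rV[R]_N) (T : 'M[R]_(N.-1, N)) (g : 'rV[R]_(N.-1) -> R),
    local_graph S x nu T g /\
    char_poly (hess g 0) = \prod_(i < N.-1) ('X - (k i)%:P).

Definition level_set (R : realType) (N : nat) (Omega : set 'rV[R]_N)
    (u : 'rV[R]_N -> R) (x : 'rV[R]_N) : set 'rV[R]_N :=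
  [set y | Omega y /\ u y = u x].

Definition noncritical (R : realType) (N : nat) (Omega : set 'rV[R]_N)
    (u : 'rV[R]_N -> R) : set 'rV[R]_N :=
  [set y | Omega y /\ grad u y != 0].

(* Main.v *)
Require Import Defs.
From mathcomp Require Import all_boot all_order all_algebra.
From mathcomp Require Import all_classical all_reals all_analysis.
From mathcomp Require Import ring lra.
Import Order.TTheory GRing.Theory Num.Theory.
Import numFieldNormedType.Exports.
Local Open Scope classical_set_scope.
Local Open Scope ring_scope.

(** Write [p] for the gradient of [u] at [x], [A] for the Hessian of [H] at [p]
    and [q v] for the quadratic form [dot (v *m A) v]. Near [x] the level set is
    the graph of [g] in an orthonormal frame made of a unit normal [nu] and of
    tangent vectors, the rows of [T].

    The gradient of |grad u| is the derivative of grad u in the direction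
    [p / |p|], which is [nu] up to sign, while the sum of the [q (grad u_i)] is
    the trace of [M *m A *m M^T], where the rows of [M] are the [grad u_i]. As a
    trace may be computed in any orthonormal frame, the subtraction removes the
    normal contribution, and the sum of [q (row a (T *m M))] over the tangent
    directions [a] remains ([trace_sub_normal]).

    By homogeneity [A] annihilates [p] on both sides, so [q v] does not change
    when [v] is moved along [p]. Euler's identity [dot p (grad H p) = H p <> 0]
    shows that such a move can make [v] orthogonal to [grad H p], where uniform
    ellipticity applies; since the tangential components of [v] have not
    changed, [q v] is at least [Lambda / H p] times their squared length
    ([finsler_hess_ge]).

    It remains to bound the squared entries of [T *m M *m T^T]. Differentiating
    [u (x + w *m T + g w *: nu) = u x] once shows that [p] is a multiple of [nu]
    ([level_tangent]); differentiating it twice shows that [T *m hess u x *m T^T]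
    is [- dot nu p] times the Hessian of [g] ([level_hess]). The squared entries
    of the latter sum to at least the sum of the squares of its eigenvalues
    ([sum_sqr_eigenvalues_le]). Hence the ellipticity constant [Lambda] itself
    can serve as [CH]. *)

(** * Squares of the eigenvalues of a matrix *)

Lemma char_poly_comp {R : comNzRingType} {n : nat} (S : 'M[R]_n)
    (q : {poly R}) :
  char_poly S \Po q = \det (q%:M - map_mx polyC S).
Proof.
rewrite /char_poly -[LHS]/(comp_poly q _) -det_map_mx; congr (\det _).
by apply/matrixP => i j; rewrite !mxE raddfB raddfMn /= comp_polyX comp_polyC.
Qed.

(** Substituting X^2 for X is injective on polynomials, and afterwards both
    sides factor: X^2 - S^2 = - (X - S) (- X - S), and likewise for each
    [k i]. *)
Lemma char_poly_sqr {R : idomainType} {n : nat} {S : 'M[R]_n} {k : 'I_n -> R} :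
  char_poly S = \prod_(i < n) ('X - (k i)%:P) ->
  char_poly (S *m S) = \prod_(i < n) ('X - (k i ^+ 2)%:P).
Proof.
move=> Sk; apply/eqP.
rewrite -subr_eq0 -(@comp_poly_eq0 _ _ 'X^2) ?size_polyXn //.
rewrite comp_polyB subr_eq0 char_poly_comp.
have -> : ('X^2)%:M - map_mx polyC (S *m S) =
    -1 *: (('X%:M - map_mx polyC S) *m ((- 'X)%:M - map_mx polyC S)).
  have XN m : (- m)%:M = - m%:M :> 'M[{poly R}]_n by exact: raddfN.
  rewrite map_mxM /= scaleN1r mulmxBl !mulmxBr -scalar_mxM.
  rewrite scalar_mxC mulrN -expr2 !XN mulNmx.
  by rewrite opprB opprD !opprK [_ + 'X%:M *m _]addrC addrACA addNr add0r addrC.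
rewrite detZ det_mulmx -!char_poly_comp comp_polyXr Sk rmorph_prod.
rewrite [X in _ == X]rmorph_prod /= -[X in (-1) ^+ X]card_ord -prodr_const.
rewrite -!big_split /=; apply/eqP/eq_bigr => i _.
rewrite !comp_polyB !comp_polyX !comp_polyC rmorphXn /=; ring.
Qed.

(** The left-hand side is the trace of [S *m S], that is the sum of the
    [S i j * S j i], each at most half of [S i j ^+ 2 + S j i ^+ 2]. *)
Lemma sum_sqr_eigenvalues_le {R : realDomainType} {n : nat} {S : 'M[R]_n}
    {k : 'I_n -> R} :
  char_poly S = \prod_(i < n) ('X - (k i)%:P) ->
  \sum_(i < n) k i ^+ 2 <= \sum_(i < n) \sum_(j < n) S i j ^+ 2.
Proof.
case: n S k => [|n] S k Sk; first by rewrite !big_ord0.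
have := congr1 (fun p : {poly R} => p`_n) (char_poly_sqr Sk).
rewrite -[X in _`_X]/(n.+1.-1) char_poly_trace //.
rewrite -(big_map (fun i => k i ^+ 2) predT (fun a => 'X - a%:P)).
set ps := map _ _.
have sz : n.+1 = size ps by rewrite size_map /index_enum -enumT size_enum_ord.
have -> : (\prod_(a <- ps) ('X - a%:P))`_n = - \sum_(a <- ps) a.
  by rewrite -coefPn_prod_XsubC -sz.
move=> /oppr_inj.
rewrite /ps big_map => <-.
rewrite -(ler_pM2l (ltr0n _ 2)) // mulr_natl mulr2n.
rewrite [in X in _ <= X]mulr_natl mulr2n.
rewrite [X in _ <= _ + X]exchange_big -!big_split /=; apply: ler_sum => i _.
rewrite mxE -!big_split; apply: ler_sum => j _ /=.
have := sqr_ge0 (S i j - S j i); nra.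
Qed.

(** * Euclidean geometry of row vectors *)

Lemma dotE {R : realType} {N : nat} (v w : 'rV[R]_N) :
  dot v w = (v *m w^T) 0 0.
Proof. by rewrite mxE; apply: eq_bigr => i _; rewrite mxE. Qed.

Lemma dotC {R : realType} {N : nat} (v w : 'rV[R]_N) : dot v w = dot w v.
Proof. by apply: eq_bigr => i _; rewrite mulrC. Qed.

Lemma dotr0 {R : realType} {N : nat} (v : 'rV[R]_N) : dot v 0 = 0.
Proof. by rewrite dotE trmx0 mulmx0 mxE. Qed.

Lemma dot_ge0 {R : realType} {N : nat} (v : 'rV[R]_N) : 0 <= dot v v.
Proof. by apply: sumr_ge0 => i _; rewrite -expr2 sqr_ge0. Qed.

Lemma enorm_sqr {R : realType} {N : nat} (v : 'rV[R]_N) :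
  enorm v ^+ 2 = dot v v.
Proof. by rewrite sqr_sqrtr ?dot_ge0. Qed.

Lemma dot_eq0 {R : realType} {N : nat} (v : 'rV[R]_N) :
  (dot v v == 0) = (v == 0).
Proof.
apply/idP/eqP => [|->]; last by rewrite dotr0.
rewrite psumr_eq0 => [/allP v0|i _]; last by rewrite -expr2 sqr_ge0.
apply/rowP => i; rewrite mxE; have := v0 i (mem_index_enum _).
by rewrite mulf_eq0 orbb => /eqP.
Qed.

Lemma enorm_gt0 {R : realType} {N : nat} (v : 'rV[R]_N) :
  v != 0 -> 0 < enorm v.
Proof. by move=> v0; rewrite sqrtr_gt0 lt0r dot_eq0 v0 dot_ge0. Qed.

(** Bessel's inequality: the difference of the two sides is the squared length
    of the component of [v] orthogonal to the rows of [T]. *)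
Lemma bessel {R : realType} {m N : nat} (T : 'M[R]_(m, N)) (v : 'rV[R]_N) :
  T *m T^T = 1%:M -> dot (v *m T^T) (v *m T^T) <= dot v v.
Proof.
move=> TT; set w := v *m T^T; have := dot_ge0 (v - w *m T).
have -> : dot (v - w *m T) (v - w *m T) = dot v v - dot w w; last first.
  by rewrite subr_ge0.
have tr : (v - w *m T)^T = v^T - T^T *m w^T by rewrite -trmx_mul; exact: raddfB.
have wTT : w *m T *m T^T = w by rewrite -mulmxA TT mulmx1.
rewrite !dotE tr mulmxBl !mulmxBr !mulmxA wTT -/w.
have -> : w *m T *m v^T = w *m w^T by rewrite -mulmxA trmx_mul trmxK.
by rewrite subrr subr0 [LHS]mxE [X in _ + X]mxE.
Qed.

Lemma frame_complete {R : comUnitRingType} {n : nat} {nu : 'rV[R]_n.+1}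
    {T : 'M[R]_(n, n.+1)} :
  nu *m nu^T = 1%:M -> T *m T^T = 1%:M -> T *m nu^T = 0 ->
  nu^T *m nu + T^T *m T = 1%:M.
Proof.
move=> nn TT Tn; have nT : nu *m T^T = 0.
  by apply: trmx_inj; rewrite trmx_mul trmxK Tn trmx0.
pose Q : 'M[R]_(1 + n) := col_mx nu T.
have QQ : Q *m Q^T = 1%:M.
  by rewrite tr_col_mx mul_col_row nn TT Tn nT -scalar_mx_block.
by have := mulmx1C QQ; rewrite tr_col_mx mul_row_col.
Qed.

Lemma sum_dot_rows {R : realType} {m N : nat} (A : 'M[R]_N)
    (X : 'M[R]_(m, N)) :
  \sum_(a < m) dot (row a X *m A) (row a X) = \tr (X *m A *m X^T).
Proof.
apply: eq_bigr => a _; rewrite dotE -row_mul [RHS]mxE mxE.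
by apply: eq_bigr => j _; rewrite !mxE.
Qed.

(** The trace of [M *m A *m M^T] splits over the orthonormal frame made of [nu]
    and of the rows of [T]; the subtracted term is the share of [nu]. *)
Lemma trace_sub_normal {R : realType} {m N : nat} (A M : 'M[R]_N)
    (nu : 'rV[R]_N) (T : 'M[R]_(m, N)) :
  nu^T *m nu + T^T *m T = 1%:M ->
  \tr (M *m A *m M^T) - dot (nu *m M *m A) (nu *m M) =
    \tr (T *m M *m A *m (T *m M)^T).
Proof.
move=> frame; set B := M *m A *m M^T.
have -> : dot (nu *m M *m A) (nu *m M) = \tr (nu *m B *m nu^T).
  by rewrite dotE trmx_mul !mulmxA [RHS]/mxtrace big_ord1.
have -> : \tr (T *m M *m A *m (T *m M)^T) = \tr (T *m B *m T^T).
  by rewrite trmx_mul !mulmxA.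
have -> : \tr B = \tr (nu *m B *m nu^T) + \tr (T *m B *m T^T).
  rewrite (mxtrace_mulC (nu *m B)) (mxtrace_mulC (T *m B)) !(mulmxA _ _ B).
  by rewrite -mxtraceD -mulmxDl frame mul1mx.
by rewrite addrC addKr.
Qed.

(** * Directional derivatives *)

Lemma derive_line {R : realType} {V W : normedModType R} (f : V -> W)
    (x v : V) :
  'D_v f x = 'D_1 (fun h : R => f (h *: v + x)) 0.
Proof.
rewrite /derive; set g1 := fun h => h^-1 *: _; set g2 := fun h => h^-1 *: _.
suff -> : g1 = g2 by [].
by apply/funext => h; rewrite /g1 /g2 /= addr0 scale0r add0r [_%:A]mulr1.
Qed.

(** For the inner function a directional derivative suffices: its restriction to
    the line through [x] along [v] depends on one variable, where being
    derivable is the same as being differentiable. *)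
Lemma is_derive_chain {R : realType} {U V W : normedModType R}
    {f : V -> W} {c : U -> V} {x v : U} {d : V} :
  differentiable f (c x) -> is_derive x v c d ->
  is_derive x v (f \o c) ('D_d f (c x)).
Proof.
move=> df [/derivable1P dc <-].
set c1 := fun h : R => c (h *: v + x) in dc.
have c10 : c1 0 = c x by rewrite /c1 scale0r add0r.
have/derivable1_diffP dc1 := dc.
have df1 : differentiable f (c1 0) by rewrite c10.
have dfc : differentiable (f \o c1) 0 by exact/differentiable_comp.
have der : derivable (f \o c) x v.
  by apply/derivable1P; apply/derivable1_diffP.
apply: DeriveDef => //.
have -> : 'D_v (f \o c) x = 'D_1 (f \o c1) 0 by rewrite derive_line.
rewrite deriveE // diff_comp //=.
rewrite -deriveE // -deriveE //.
have -> : 'D_v c x = 'D_1 c1 0 by exact: derive_line.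
by rewrite c10.
Qed.

(** The difference quotients of a linear map are constant. *)
Lemma is_derive_linear {R : realType} {V W : normedModType R}
    (L : {linear V -> W}) (x v : V) : is_derive x v L (L v).
Proof.
have lim : (fun h : R => h^-1 *: ((L \o shift x) (h *: v) - L x)) @ 0^'
    --> L v.
  apply: cvg_near_cst; near=> h.
  rewrite /= [L _]linearD addrK linearZ scalerA mulVf ?scale1r //.
  by near: h; exact: nbhs_dnbhs_neq.
by apply: DeriveDef; [apply/cvg_ex; exists (L v)|exact: cvg_lim].
Unshelve. all: by end_near.
Qed.

Lemma is_deriveZl {R : realType} {V W : normedModType R} (g : V -> R)
    (w : W) (x v : V) (d : R) :
  is_derive x v g d -> is_derive x v (fun y => g y *: w) (d *: w).
Proof.
move=> [dg <-].
have lim : (fun h : R => h^-1 *: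
    (((fun y => g y *: w) \o shift x) (h *: v) - g x *: w)) @ 0^'
    --> 'D_v g x *: w.
  rewrite (_ : (fun h : R => _) =
    fun h => (h^-1 *: ((g \o shift x) (h *: v) - g x)) *: w); last first.
    by apply/funext => h /=; rewrite -scalerBl scalerA.
  exact: cvgZr_tmp.
by apply: DeriveDef; [apply/cvg_ex; exists ('D_v g x *: w)|exact: cvg_lim].
Qed.

Lemma is_derive_coord {R : realType} {N : nat} (p v : 'rV[R]_N) (j : 'I_N) :
  is_derive p v (fun y : 'rV[R]_N => y 0 j) (v 0 j).
Proof.
apply: DeriveDef.
  by have /derivable_mxP := @derivable_id _ 'rV[R]_N p v; exact.
have /matrixP/(_ 0 j) := derive_mx (@derivable_id _ 'rV[R]_N p v).
by rewrite derive_id mxE => ->.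
Qed.

Lemma derive_dot {R : realType} {N : nat} {f : 'rV[R]_N -> R}
    {x v : 'rV[R]_N} :
  differentiable f x -> 'D_v f x = dot v (grad f x).
Proof.
move=> df; rewrite deriveE // [in LHS](row_sum_delta v) linear_sum.
by apply: eq_bigr => i _; rewrite linearZ mxE /partial deriveE.
Qed.

(** A form of Euler's identity that covers both degrees of homogeneity needed:
    [c = f p] for degree 1 and [c = 0] for degree 0. *)
Lemma derive_radial {R : realType} {V : normedModType R} (f : V -> R)
    (p : V) (c : R) :
  (forall t, 0 < t -> f (t *: p) = f p + (t - 1) * c) -> 'D_p f p = c.
Proof.
move=> hom; apply: cvg_lim => //; apply: cvg_near_cst; near=> h.
have h0 : h != 0 by near: h; exact: nbhs_dnbhs_neq.
have h1 : `|h| < 1 by near: h; exact: dnbhs0_lt.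
have t0 : 0 < h + 1 by move: h1; rewrite ltr_norml => /andP[]; lra.
have -> : ((f \o shift p) (h *: p) - f p) = h * c.
  rewrite /= -[X in f (_ + X)]scale1r -scalerDl hom // addrK.
  by rewrite addrAC subrr add0r.
by rewrite [LHS]mulrA mulVf ?mul1r.
Unshelve. all: by end_near.
Qed.

Lemma derive_scale {R : realType} {V : normedModType R} (f : V -> R) (s a : R)
    (x v : V) :
  differentiable f x -> differentiable f (s *: x) ->
  (forall y, f (s *: y) = a * f y) -> s * 'D_v f (s *: x) = a * 'D_v f x.
Proof.
move=> dfx dfsx hom.
have [_ chain] :=
  is_derive_chain dfsx (is_derive_linear ( *:%R s : {linear V -> V}) x v).
have -> : s * 'D_v f (s *: x) = 'D_(s *: v) f (s *: x).
  by rewrite !deriveE // linearZ.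
rewrite -chain (_ : f \o _ = a *: f); last by apply/funext => y; rewrite /= hom.
by rewrite deriveZ //; exact: diff_derivable.
Qed.

(** The gradient of the length of the gradient is the derivative of the gradient
    in the direction of the gradient. The Hessian appears transposed because row
    [i] of [(hess u x)^T] is the gradient of [partial i u]. *)
Lemma grad_enorm_grad {R : realType} {N : nat} {u : 'rV[R]_N -> R}
    {x : 'rV[R]_N} :
  (forall i, differentiable (partial i u) x) -> grad u x != 0 ->
  grad (fun y => enorm (grad u y)) x =
    (enorm (grad u x))^-1 *: (grad u x *m (hess u x)^T).
Proof.
move=> du p0; apply/rowP => l; rewrite [LHS]mxE [RHS]mxE [X in _ * X]mxE.
pose F : 'rV[R]_N -> R := \sum_(i < N) (partial i u * partial i u).
have FE y : dot (grad u y) (grad u y) = F y.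
  by rewrite /F fct_sumE; apply: eq_bigr => i _; rewrite !mxE.
have s0 : 0 < F x by rewrite -FE lt0r dot_eq0 p0 dot_ge0.
have dF : is_derive x (delta_mx 0 l) F (\sum_(i < N)
    (partial i u x *: hess u x l i + partial i u x *: hess u x l i)).
  have di i : is_derive x (delta_mx 0 l) (partial i u) (hess u x l i).
    by rewrite mxE; apply: derivableP; exact: diff_derivable.
  by apply: is_derive_sum => i; exact: is_deriveM.
have dsqrt : differentiable (Num.sqrt : R -> R) (F x).
  by apply/derivable1_diffP; have [] := is_derive1_sqrt s0.
have [_ dval] := is_derive_chain dsqrt dF.
have -> : (fun y => enorm (grad u y)) = Num.sqrt \o F.
  by apply/funext => y; rewrite /= -FE.
rewrite /partial dval big_split /= deriveE //.
rewrite -[X in 'd _ _ X]mulr1 [LHS]linearZ -deriveE //.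
have [_ ->] := is_derive1_sqrt s0.
rewrite -FE -/(enorm (grad u x)) invfM.
have -> : \sum_j grad u x 0 j * (hess u x)^T j l =
    \sum_(i < N) partial i u x *: hess u x l i.
  by apply: eq_bigr => i _; rewrite !mxE.
set S := \sum_(i < N) _; rewrite -[LHS]/((S + S) * (2^-1 / enorm (grad u x))).
by field; rewrite gt_eqF // enorm_gt0.
Qed.

(** * The Hessian of a Finsler norm *)

Lemma finsler_differentiable {R : realType} {N : nat} {H : 'rV[R]_N -> R} :
  finsler_norm H -> forall p, p != 0 -> differentiable H p /\
    forall j, differentiable (partial j H) p.
Proof.
case=> _ [beta [_ _ [[dH C2] _]]] _ _ _ p p0; split=> [|j]; first exact: dH.
by case: (C2 j) => d2H _; exact: d2H.
Qed.

Lemma finsler_partial_scale {R : realType} {N : nat} {H : 'rV[R]_N -> R}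
    (hH : finsler_norm H) (j : 'I_N) (s : R) (y : 'rV[R]_N) :
  0 < s -> partial j H (s *: y) = partial j H y.
Proof.
move=> s0; have [->|y0] := eqVneq y 0; first by rewrite scaler0.
have sy0 : s *: y != 0 by rewrite scaler_eq0 negb_or gt_eqF.
have [dHy _] := finsler_differentiable hH y y0.
have [dHsy _] := finsler_differentiable hH (s *: y) sy0.
apply: (mulfI (lt0r_neq0 s0)); apply: derive_scale => // z.
by rewrite (finsler_homogeneous hH) gtr0_norm.
Qed.

(** At [y = 0], where [H] need not be differentiable, both sides vanish. Having
    the identity everywhere allows it to be differentiated as an equality of
    functions in [finsler_hess_radial_r]. *)
Lemma finsler_euler {R : realType} {N : nat} {H : 'rV[R]_N -> R}
    (hH : finsler_norm H) (y : 'rV[R]_N) : dot y (grad H y) = H y.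
Proof.
have [->|y0] := eqVneq y 0.
  rewrite -(scale0r 0) (finsler_homogeneous hH) normr0 mul0r /dot big1 // => i _.
  by rewrite scale0r mxE mul0r.
have [dHy _] := finsler_differentiable hH y y0.
rewrite -derive_dot //; apply: derive_radial => t t0.
by rewrite (finsler_homogeneous hH) gtr0_norm //; ring.
Qed.

(** The first partial derivatives are homogeneous of degree 0, hence constant
    along the ray through [p]. *)
Lemma finsler_hess_radial_l {R : realType} {N : nat} {H : 'rV[R]_N -> R}
    (hH : finsler_norm H) {p : 'rV[R]_N} : p != 0 -> p *m hess H p = 0.
Proof.
move=> p0; have [_ d2H] := finsler_differentiable hH p p0.
apply/rowP => j; rewrite [RHS]mxE.
have -> : (p *m hess H p) 0 j = dot p (grad (partial j H) p).
  by rewrite mxE; apply: eq_bigr => i _; rewrite !mxE.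
rewrite -derive_dot //; apply: derive_radial => t t0.
by rewrite (finsler_partial_scale hH) // mulr0 addr0.
Qed.

(** Differentiating Euler's identity along the i-th axis gives the partial
    derivative of [H] on both sides; what is left on one side is the i-th entry
    of [hess H p *m p^T]. *)
Lemma finsler_hess_radial_r {R : realType} {N : nat} {H : 'rV[R]_N -> R}
    (hH : finsler_norm H) {p : 'rV[R]_N} : p != 0 -> hess H p *m p^T = 0.
Proof.
move=> p0; have [_ d2H] := finsler_differentiable hH p p0.
apply/colP => i; rewrite [RHS]mxE.
have coordD j : is_derive p (delta_mx 0 i)
    (fun y : 'rV[R]_N => y 0 j) ((j == i)%:R : R).
  by apply: is_derive_eq (is_derive_coord _ _ _) _; rewrite mxE eqxx.
have partialD j : is_derive p (delta_mx 0 i) (partial j H) (hess H p i j).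
  by rewrite mxE; apply: derivableP; exact: diff_derivable.
have eulerD : is_derive p (delta_mx 0 i)
    (\sum_(j < N) ((fun y : 'rV[R]_N => y 0 j) * partial j H))
    (\sum_(j < N) (p 0 j *: hess H p i j + partial j H p *: (j == i)%:R)).
  by apply: is_derive_sum => j; exact: is_deriveM.
move: eulerD; rewrite (_ : \sum_(j < N) _ = H); last first.
  apply/funext => y; rewrite fct_sumE -[RHS](finsler_euler hH).
  by apply: eq_bigr => j _; rewrite mxE.
case=> _ ; rewrite big_split /= -[LHS]/(partial i H p).
have -> : \sum_(j < N) partial j H p *: (j == i)%:R = partial i H p.
  rewrite (bigD1 i) //= eqxx big1 ?addr0 => [|j /negbTE->].
    exact: mulr1.
  by rewrite scaler0.
move=> E.
rewrite mxE; apply: (addIr (partial i H p)); rewrite add0r [RHS]E; congr (_ + _).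
by apply: eq_bigr => j _; rewrite [p^T _ _]mxE mulrC.
Qed.

Lemma finsler_hess_scale {R : realType} {N : nat} {H : 'rV[R]_N -> R}
    (hH : finsler_norm H) (p : 'rV[R]_N) (s : R) : p != 0 -> 0 < s ->
  hess H p = s *: hess H (s *: p).
Proof.
move=> p0 s0; have sp0 : s *: p != 0 by rewrite scaler_eq0 negb_or gt_eqF.
have [_ d2H] := finsler_differentiable hH p p0.
have [_ d2Hs] := finsler_differentiable hH _ sp0.
apply/matrixP => i j; rewrite !mxE; apply/esym; rewrite -[RHS]mul1r.
by apply: derive_scale => // y; rewrite mul1r; exact: finsler_partial_scale.
Qed.

(** The form does not see a change of [v] along [p], and neither do the
    components of [v] on the rows of [T]. So [v] may be replaced by [v'], the
    vector of the line [v + R p] that is orthogonal to [grad H p]; ellipticity at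
    the normalised point [p / H p] bounds the form at [v'] by the full length of
    [v'], which dominates that of its components. *)
Lemma finsler_hess_ge {R : realType} {m N : nat} {H : 'rV[R]_N -> R}
    (hH : finsler_norm H) {Lambda : R} {p : 'rV[R]_N} (v : 'rV[R]_N)
    {T : 'M[R]_(m, N)} :
  (forall xi v, H xi = 1 -> dot (grad H xi) v = 0 ->
      Lambda * enorm v ^+ 2 <= dot (v *m hess H xi) v) ->
  0 < Lambda -> p != 0 -> T *m T^T = 1%:M -> T *m p^T = 0 ->
  Lambda / H p * dot (v *m T^T) (v *m T^T) <= dot (v *m hess H p) v.
Proof.
move=> ell L0 p0 TT Tp.
have Hp : 0 < H p by exact: (finsler_gt0 hH).
have s0 : 0 < (H p)^-1 by rewrite invr_gt0.
pose c := dot v (grad H p) / H p; pose v' := v - c *: p.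
have pT : p *m T^T = 0 by apply: trmx_inj; rewrite trmx_mul trmxK trmx0.
have -> : v *m T^T = v' *m T^T by rewrite mulmxBl -scalemxAl pT scaler0 subr0.
have -> : dot (v *m hess H p) v = dot (v' *m hess H p) v'.
  have -> : v' *m hess H p = v *m hess H p.
    by rewrite mulmxBl -scalemxAl (finsler_hess_radial_l hH p0) scaler0 subr0.
  have hess_v' : hess H p *m v'^T = hess H p *m v^T.
    have -> : v'^T = v^T - c *: p^T by rewrite -linearZ; exact: raddfB.
    by rewrite mulmxBr -scalemxAr (finsler_hess_radial_r hH p0) scaler0 subr0.
  by rewrite dotE [RHS]dotE -!mulmxA hess_v'.
apply: (@le_trans _ _ (Lambda / H p * dot v' v')).
  by rewrite ler_wpM2l ?bessel // ltW // divr_gt0.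
rewrite (finsler_hess_scale hH p (H p)^-1) //.
have -> : dot (v' *m ((H p)^-1 *: hess H ((H p)^-1 *: p))) v' =
    (H p)^-1 * dot (v' *m hess H ((H p)^-1 *: p)) v'.
  by rewrite !dotE -scalemxAr -scalemxAl mxE.
rewrite mulrAC mulrC ler_pM2l // -enorm_sqr; apply: ell.
  by rewrite (finsler_homogeneous hH) gtr0_norm // mulVf ?gt_eqF.
have -> : grad H ((H p)^-1 *: p) = grad H p.
  by apply/rowP => j; rewrite !mxE (finsler_partial_scale hH).
have dotB (q : 'rV[R]_N) : dot q v' = dot q v - c * dot q p.
  rewrite /dot mulr_sumr -sumrB; apply: eq_bigr => i _.
  by rewrite !mxE mulrBr mulrCA.
rewrite dotB dotC [X in _ - _ * X]dotC (finsler_euler hH).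
by rewrite /c mulfVK ?subrr // gt_eqF.
Qed.

(** * Level sets as graphs *)

Definition graph_map {R : realType} {m N : nat} (x nu : 'rV[R]_N)
    (T : 'M[R]_(m, N)) (g : 'rV[R]_m -> R) (w : 'rV[R]_m) : 'rV[R]_N :=
  x + w *m T + g w *: nu.

Lemma is_derive_graph {R : realType} {m N : nat} (x nu : 'rV[R]_N)
    (T : 'M[R]_(m, N)) (g : 'rV[R]_m -> R) (w v : 'rV[R]_m) :
  differentiable g w ->
  is_derive w v (graph_map x nu T g) (v *m T + 'D_v g w *: nu).
Proof.
move=> dg; rewrite -[v *m T]add0r.
apply: is_deriveD; first apply: is_deriveD.
  exact: (is_derive_linear (mulmxr T)).
by apply: is_deriveZl; apply: derivableP; exact: diff_derivable.
Qed.

Lemma graph_map0 {R : realType} {N : nat} {S : set 'rV[R]_N} {x nu : 'rV[R]_N}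
    {T : 'M[R]_(N.-1, N)} {g : 'rV[R]_(N.-1) -> R} :
  local_graph S x nu T g -> graph_map x nu T g 0 = x.
Proof.
by case=> _ [g0 _ _]; rewrite /graph_map mul0mx g0 scale0r !addr0.
Qed.

(** Continuity of [g] keeps the height [g w] within the box in which the graph
    description of [S] is valid. *)
Lemma graph_near {R : realType} {N : nat} {S : set 'rV[R]_N} {x nu : 'rV[R]_N}
    {T : 'M[R]_(N.-1, N)} {g : 'rV[R]_(N.-1) -> R} :
  local_graph S x nu T g ->
  exists2 r : R, 0 < r & class_C 2 (ball 0 r) g /\
    \forall w \near (0 : 'rV[R]_(N.-1)), ball 0 r w /\ S (graph_map x nu T g w).
Proof.
case=> _ [g0 dg0 [r r0 [Cg grS]]]; exists r => //; split=> //.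
have [dg _] := Cg.
have cg : {for 0, continuous g}.
  by apply: differentiable_continuous; apply: dg; exact: ballxx.
have near_g : \forall w \near (0 : 'rV[R]_(N.-1)), ball (g 0) r (g w).
  by apply: cg; exact: nbhsx_ballx.
have near_b : \forall w \near (0 : 'rV[R]_(N.-1)), ball 0 r w.
  exact: nbhsx_ballx.
near=> w; have bw : ball 0 r w by near: w.
have bg : ball (g 0) r (g w) by near: w.
split=> //; apply/grS => //.
by move: bg; rewrite g0 -ball_normE /= sub0r normrN.
Unshelve. all: by end_near.
Qed.

(** First derivative of the constant function [u \o graph_map x nu T g], at all
    points near 0, so that it can be differentiated again at 0. *)
Lemma level_first {R : realType} {N : nat} {Omega : set 'rV[R]_N}
    {u : 'rV[R]_N -> R} {x nu : 'rV[R]_N} {T : 'M[R]_(N.-1, N)}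
    {g : 'rV[R]_(N.-1) -> R} :
  (forall y, Omega y -> differentiable u y) ->
  local_graph (level_set Omega u x) x nu T g ->
  \forall w \near (0 : 'rV[R]_(N.-1)), forall v,
    dot (v *m T + 'D_v g w *: nu) (grad u (graph_map x nu T g w)) = 0.
Proof.
move=> du graph; have [r r0 [[dg _] nr]] := graph_near graph.
have nnr := near_join nr.
near=> w => v.
have [bw [Ow _]] : ball 0 r w /\ level_set Omega u x (graph_map x nu T g w).
  by near: w.
have uc : \forall w' \near w, cst (u x) w' = (u \o graph_map x nu T g) w'.
  have : \forall w' \near w,
      ball 0 r w' /\ level_set Omega u x (graph_map x nu T g w') by near: w.
  by apply: filterS => w' [_ [_ /esym]].
have := is_derive_chain (du _ Ow) (is_derive_graph x nu T g w v (dg _ bw)).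
rewrite derive_dot; last exact: du.
case=> _ <-; rewrite -(near_eq_derive _ uc).
exact: derive_cst.
Unshelve. all: by end_near.
Qed.

Lemma level_tangent {R : realType} {N : nat} {Omega : set 'rV[R]_N}
    {u : 'rV[R]_N -> R} {x nu : 'rV[R]_N} {T : 'M[R]_(N.-1, N)}
    {g : 'rV[R]_(N.-1) -> R} :
  (forall y, Omega y -> differentiable u y) ->
  local_graph (level_set Omega u x) x nu T g ->
  T *m (grad u x)^T = 0.
Proof.
move=> du graph; have [r r0 [[dg _] nr]] := graph_near graph.
have [_ [_ gg0 _]] := graph.
apply/colP => a; rewrite [RHS]mxE.
have := nbhs_singleton (level_first du graph) (delta_mx 0 a).
rewrite (graph_map0 graph) derive_dot; last by apply: dg; exact: ballxx.
by rewrite gg0 dotr0 scale0r addr0 -rowE dotE -row_mul mxE.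
Qed.

(** Second derivative of the same constant function. As the graph is tangent at
    [x], the only contribution of [g] is its Hessian, multiplied by the normal
    derivative of [u]. *)
Lemma level_hess {R : realType} {N : nat} {Omega : set 'rV[R]_N}
    {u : 'rV[R]_N -> R} {x nu : 'rV[R]_N} {T : 'M[R]_(N.-1, N)}
    {g : 'rV[R]_(N.-1) -> R} :
  (forall y, Omega y -> differentiable u y) ->
  local_graph (level_set Omega u x) x nu T g ->
  (forall i, differentiable (partial i u) x) ->
  T *m hess u x *m T^T = - dot nu (grad u x) *: hess g 0.
Proof.
move=> du graph d2u; have [r r0 [[dg d2g] nr]] := graph_near graph.
have [_ [_ gg0 _]] := graph.
have b0 : ball (0 : 'rV[R]_(N.-1)) r 0 by exact: ballxx.
apply/matrixP => a b.
have dgam : is_derive 0 (delta_mx 0 a) (graph_map x nu T g) (row a T).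
  apply: is_derive_eq (is_derive_graph x nu T g _ _ (dg _ b0)) _.
  rewrite derive_dot; last exact: dg.
  by rewrite gg0 dotr0 scale0r addr0 -rowE.
have dpu j : is_derive 0 (delta_mx 0 a) (partial j u \o graph_map x nu T g)
    (dot (row a T) (grad (partial j u) x)).
  have d2u0 : differentiable (partial j u) (graph_map x nu T g 0).
    by rewrite (graph_map0 graph).
  apply: is_derive_eq (is_derive_chain d2u0 dgam) _.
  by rewrite (derive_dot d2u0) (graph_map0 graph).
have dpg : is_derive 0 (delta_mx 0 a) (partial b g) (hess g 0 a b).
  rewrite mxE; apply: derivableP; apply: diff_derivable.
  by case: (d2g b) => d _; exact: d.
have dtan j : is_derive 0 (delta_mx 0 a)
    (fun w => T b j + partial b g w * nu 0 j) (hess g 0 a b * nu 0 j).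
  rewrite -[X in is_derive _ _ _ X]add0r; apply: is_deriveD.
  exact: is_deriveZl.
have := is_derive_sum (fun j : 'I_N => is_deriveM (dtan j) (dpu j)).
(* [Phi] is the left-hand side of [level_first] in the b-th direction. *)
set Phi := \sum_(j < N) _ => -[_ dPhi].
have Phi0 : \forall w \near (0 : 'rV[R]_(N.-1)), cst 0 w = Phi w.
  move: (level_first du graph); apply: filterS => w /(_ (delta_mx 0 b)) <-.
  by rewrite /Phi fct_sumE; apply: eq_bigr => j _; rewrite -rowE !mxE.
move: dPhi; rewrite -(near_eq_derive _ Phi0) derive_cst.
have pg0 : partial b g 0 = 0 by have /rowP/(_ b) := gg0; rewrite !mxE.
rewrite big_split /= (graph_map0 graph) pg0.
have -> : \sum_(j < N) ((T b j + 0 * nu 0 j) *: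
    dot (row a T) (grad (partial j u) x)) = (T *m hess u x *m T^T) a b.
  rewrite mxE; apply: eq_bigr => j _.
  rewrite mul0r addr0 -[LHS]/(T b j * _) mulrC [T^T _ _]mxE; congr (_ * _).
  by rewrite mxE; apply: eq_bigr => l _; rewrite !mxE.
have -> : \sum_(j < N) (partial j u x *: (hess g 0 a b * nu 0 j)) =
    hess g 0 a b * dot nu (grad u x).
  rewrite mulr_sumr; apply: eq_bigr => j _.
  by rewrite -[LHS]/(partial j u x * _) [X in nu 0 j * X]mxE mulrC mulrA.
move=> E; rewrite [RHS]mxE mulNr mulrC; apply/eqP; rewrite -subr_eq0 opprK.
by rewrite -E.
Qed.

(** * The curvature inequality *)

Theorem lemma3p3 (R : realType) (N : nat) (H : 'rV[R]_N -> R)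
    (hH : finsler_norm H) :
  exists CH : R, 0 < CH /\
    forall (Omega : set 'rV[R]_N) (u : 'rV[R]_N -> R),
      open Omega ->
      class_C 1 Omega u ->
      class_C 2 (noncritical Omega u) u ->
      forall (x : 'rV[R]_N) (k : 'I_(N.-1) -> R),
        noncritical Omega u x ->
        principal_curvatures (level_set Omega u x) x k ->
        \sum_(i < N) dot (grad (partial i u) x *m hess H (grad u x))
                         (grad (partial i u) x)
          - dot (grad (fun y => enorm (grad u y)) x *m hess H (grad u x))
                (grad (fun y => enorm (grad u y)) x)
        >= CH / H (grad u x) * enorm (grad u x) ^+ 2
             * \sum_(i < N.-1) k i ^+ 2.
Proof.
have [L [L0 ell]] := finsler_elliptic hH; exists L; split=> //.
move=> Omega u _ [du _] [_ d2u] x k ncx [nu [T [g [gr kS]]]].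
have {}d2u i : differentiable (partial i u) x by case: (d2u i) => d _; exact: d.
have [_ p0] := ncx.
have tan := level_tangent du gr.
have Hh := level_hess du gr d2u.
have gradn := grad_enorm_grad d2u p0.
have [[nn TT Tn] _] := gr.
have Hp : 0 < H (grad u x) by exact: (finsler_gt0 hH).
have {kS} Sk := sum_sqr_eigenvalues_le kS.
rewrite gradn; move: (hess g 0) Hh Sk => S Hh Sk {gr gradn}.
have -> : \sum_(i < N) dot (grad (partial i u) x *m hess H (grad u x))
    (grad (partial i u) x) =
    \tr ((hess u x)^T *m hess H (grad u x) *m (hess u x)^T^T).
  rewrite -sum_dot_rows; apply: eq_bigr => i _.
  have -> // : grad (partial i u) x = row i (hess u x)^T.
  by apply/rowP => j; rewrite !mxE.
set p := grad u x in p0 tan Hh Hp *.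
set M := (hess u x)^T.
have {}Hh : T *m M *m T^T = - dot nu p *: S^T.
  by rewrite -linearZ /= -Hh !trmx_mul trmxK mulmxA.
have hess_ge := fun v => finsler_hess_ge hH v ell L0 p0 TT tan.
move: (hess H p) hess_ge => A hess_ge.
(* Only linear algebra in dimension N is left; N = 0 is excluded by p0, and for
   N = n.+1 the frame has 1 + n vectors, as many as the dimension. *)
clearbody M p; clear - L0 p0 tan Hp nn TT Tn Sk Hh hess_ge.
case: N H nu T k p A M S p0 tan Hp nn TT Tn Sk Hh hess_ge
  => [|n] H nu T k p A M S p0 tan Hp nn TT Tn Sk Hh hess_ge.
  by case/eqP: p0; apply/rowP => -[].
rewrite /= in T k S p0 tan Hp nn TT Tn Sk Hh hess_ge *.
have frame := frame_complete nn TT Tn.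
pose c := dot nu p.
have pnu : p = c *: nu.
  rewrite -[LHS]mulmx1 -frame mulmxDr !mulmxA.
  have -> : p *m T^T = 0 by apply: trmx_inj; rewrite trmx_mul trmxK trmx0.
  rewrite mul0mx addr0 [p *m nu^T]mx11_scalar mul_scalar_mx.
  by rewrite -dotE dotC.
have pp : enorm p ^+ 2 = c ^+ 2.
  rewrite enorm_sqr {2}pnu dotE linearZ /= -scalemxAr mxE -dotE dotC.
  by rewrite expr2.
have -> : dot ((enorm p)^-1 *: (p *m M) *m A) ((enorm p)^-1 *: (p *m M)) =
    dot (nu *m M *m A) (nu *m M).
  have en0 : enorm p != 0 by rewrite gt_eqF ?enorm_gt0.
  have -> : (enorm p)^-1 *: (p *m M) = ((enorm p)^-1 * c) *: (nu *m M).
    by rewrite {2}pnu -scalemxAl scalerA.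
  rewrite dotE linearZ /= -!scalemxAl -!scalemxAr scalerA mxE -dotE.
  rewrite -expr2 exprMn exprVn -pp mulVf ?mul1r //.
  by rewrite expf_neq0.
rewrite (trace_sub_normal _ _ _ _ frame) -sum_dot_rows.
apply: (@le_trans _ _ (\sum_(a < n) (L / H p *
    dot (row a (T *m M) *m T^T) (row a (T *m M) *m T^T)))); last first.
  by apply: ler_sum => a _; exact: hess_ge.
rewrite -mulr_sumr -mulrA ler_pM2l ?divr_gt0 // pp.
have -> : \sum_(a < n) dot (row a (T *m M) *m T^T) (row a (T *m M) *m T^T) =
    c ^+ 2 * \sum_(i < n) \sum_(j < n) S i j ^+ 2.
  rewrite [in RHS]exchange_big mulr_sumr /=; apply: eq_bigr => a _.
  rewrite mulr_sumr -row_mul Hh; apply: eq_bigr => b _.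
  by rewrite !mxE -/c; ring.
by rewrite ler_wpM2l ?sqr_ge0.
Qed.
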